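(* Let $k\geq 3$ be an integer and let $G$ be a $\frac{7k-6}{10}$-tough $(P_2\cup kP_1)$-free graph. Then $G$ is hamiltonian or the Petersen graph.
   Context: All graphs are finite and simple. $\omega(G)$ denotes the number of components of $G$. For a nonnegative real number $t$, a graph $G$ is $t$-tough if $|S|\geq t\cdot\omega(G-S)$ for each vertex cut $S$ of $G$, where a vertex cut is a set $S\subseteq V(G)$ such that $G-S$ is disconnected. A graph is hamiltonian if it contains a Hamiltonian cycle, i.e. a cycle containing every vertex of the graph. $P_2\cup kP_1$ is the graph consisting of one edge and $k$ isolated vertices. For a graph $H$, a graph $G$ is $H$-free if it does not contain any induced subgraph isomorphic to $H$.
   Formalization: The formal statement assumes that G has at least three vertices; without this the claim fails for K_1 and K_2, which have no vertex cut and so are t-tough for every t but contain no cycle. *)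

(* Defs.v *)
From HB Require Import structures.
From mathcomp Require Import all_boot all_order all_algebra.
Set Implicit Arguments.
Unset Strict Implicit.
Unset Printing Implicit Defensive.
Import Order.TTheory GRing.Theory Num.Theory.

Record sgraph := SGraph {
  vertex :> finType;
  adj : rel vertex;
  adj_sym : symmetric adj;
  adj_irr : irreflexive adj }.

Definition isomorphic (G H : sgraph) : Prop :=
  exists2 f : G -> H, bijective f & forall x y, adj (f x) (f y) = adj x y.

Section Induced.
Variables (G : sgraph) (A : {set G}).

Definition induced_adj : rel {x : G | x \in A} :=
  fun x y => adj (val x) (val y).

Lemma induced_adj_sym : symmetric induced_adj.
Proof. by move=> x y; apply: adj_sym. Qed.

Lemma induced_adj_irr : irreflexive induced_adj.
Proof. by move=> x; apply: adj_irr. Qed.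

Definition induced : sgraph := SGraph induced_adj_sym induced_adj_irr.
End Induced.

Definition del_vertices (G : sgraph) (S : {set G}) : sgraph := induced (~: S).

Definition is_free (H G : sgraph) : Prop :=
  forall A : {set G}, ~ isomorphic (induced A) H.

Definition omega (G : sgraph) : nat := n_comp (@adj G) G.

Definition connected_graph (G : sgraph) : Prop :=
  forall x y : G, connect (@adj G) x y.

(* With S = V(G) the graph G - S is empty, hence connected in the above sense,
   so V(G) itself is not a vertex cut. *)
Definition vertex_cut (G : sgraph) (S : {set G}) : Prop :=
  ~ connected_graph (del_vertices S).

Definition tough (R : realFieldType) (t : R) (G : sgraph) : Prop :=
  forall S : {set G}, vertex_cut S ->
    (t * (omega (del_vertices S))%:R <= #|S|%:R)%R.

(* [cycle] and [uniq] alone would also accept the empty sequence and a single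
   edge traversed back and forth. *)
Definition is_cycle (G : sgraph) (c : seq G) : Prop :=
  [/\ 2 < size c, cycle (@adj G) c & uniq c].

Definition hamiltonian (G : sgraph) : Prop :=
  exists2 c : seq G, is_cycle c & forall x : G, x \in c.

Section P2kP1.
Variable k : nat.

Definition P2kP1_adj : rel (bool + 'I_k) :=
  fun u v => match u, v with inl a, inl b => a != b | _, _ => false end.

Lemma P2kP1_adj_sym : symmetric P2kP1_adj.
Proof. by move=> [a|i] [b|j] //=; rewrite eq_sym. Qed.

Lemma P2kP1_adj_irr : irreflexive P2kP1_adj.
Proof. by move=> [a|i] //=; rewrite eqxx. Qed.

Definition P2kP1 : sgraph := SGraph P2kP1_adj_sym P2kP1_adj_irr.
End P2kP1.

(* The Petersen graph as the Kneser graph K(5, 2). *)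
Definition petersen_adj : rel {A : {set 'I_5} | #|A| == 2} :=
  fun A B => [disjoint val A & val B].

Lemma petersen_adj_sym : symmetric petersen_adj.
Proof. by move=> A B; apply: disjoint_sym. Qed.

Lemma petersen_adj_irr : irreflexive petersen_adj.
Proof.
move=> A; apply/negbTE; rewrite /petersen_adj -setI_eq0 setIid -card_gt0.
by rewrite (eqP (valP A)).
Qed.

Definition petersen : sgraph := SGraph petersen_adj_sym petersen_adj_irr.

(* Main.v *)
Require Import Defs.
From HB Require Import structures.
From mathcomp Require Import all_boot all_order all_algebra.
From mathcomp Require Import zify lra.
Import Order.TTheory GRing.Theory Num.Theory.
Set Implicit Arguments.
Unset Strict Implicit.
Unset Printing Implicit Defensive.

(** Toughness 3/2 or more excludes the Petersen graph, whose toughness is 4/3, so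
    the graph G must be shown hamiltonian. Suppose it is not, and put
    T = 7k - 6, so that G is T/10-tough.

    Let c be a longest cycle. The usual rerouting argument shows that the
    successors on c of the neighbours of a component of G - c are pairwise
    nonadjacent and have no neighbour in that component. Toughness provides at
    least T/5 >= k of them, so a component with an edge would yield an induced
    copy of the forbidden graph: the vertices outside c are pairwise nonadjacent
    ([outside_stable]). For x outside c, the successors of the neighbours of x and
    the vertices outside c then form a stable set J, the core, with d + q
    elements, where d = deg x >= T/5 and q >= 1 is the number of vertices outside
    c ([core_stable]). Since G has no induced forbidden graph, a vertex with a
    neighbour in J has at least |J| + 1 - k of them ([dominated_many]), and the
    vertices without one form a larger stable set ([undominated_stable]).

    Choose c and x such that d is largest among all longest cycles and vertices
    omitted by them. Every vertex of J is omitted by some longest cycle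
    ([omit_succ]), hence has degree at most d. Let D be the set of vertices with a
    neighbour in J. Counting the edges between J and D gives
    |D| (|J| + 1 - k) <= |J| d, whereas toughness, applied to the stable
    complement of D, gives 10 |D| >= T |J|. Together with d >= T/5 this forces
    k = 3, d = 3, q = 1, |J| = 4 and |D| = 6, with equality everywhere
    ([extremal_parameters]).

    In this last case G has ten vertices and c consists of three triples, each
    running from a vertex of J through a vertex missing x to a neighbour of x.
    Applying the omission argument to c, to its reverse and to the cycles it
    produces shows that every vertex is omitted by some longest cycle, so all
    degrees are at most 3 ([cubic]). Each vertex of D has two neighbours in J,
    hence at most one in D; removing the four vertices of J leaves at least
    three components, against 3/2-toughness ([no_extremal]). *)

(** * Separations, stable sets and the forbidden subgraph *)

Section Separation.
Variable G : sgraph.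

Definition nbrs (v : G) : {set G} := [set u | adj v u].
Definition stable (J : {set G}) := {in J &, forall u v, ~~ adj u v}.

(** A labelling that is constant along the edges of G - S is constant on each
    component of G - S. All cuts of the proof are presented by such a
    labelling, which avoids handling components explicitly. *)
Lemma card_le_omega (S : {set G}) (fT : finType) (f : G -> fT) :
  (forall u v, u \notin S -> v \notin S -> adj u v -> f u = f v) ->
  #|f @: ~: S| <= omega (del_vertices S).
Proof.
move=> f_adj; pose D := del_vertices S.
have f_conn (u v : D) : connect (@adj D) u v -> f (val u) = f (val v).
  case/connectP=> p + ->; elim: p u => //= y p IHp u /andP[uy /IHp <-].
  by apply: f_adj uy; rewrite -in_setC; apply: valP.
have csym : connect_sym (@adj D) by apply: sym_connect_sym; apply: adj_sym.
rewrite /omega /n_comp_mem /= [X in _ <= X](_ : _ = #|[set v : D | roots (@adj D) v]|); last first.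
  by rewrite cardsE; apply: eq_card => v; rewrite !inE andbT.
apply: leq_trans _ (leq_imset_card (f \o val) _); apply: subset_leq_card.
apply/subsetP=> _ /imsetP[v vS ->].
apply/imsetP; exists (fingraph.root (@adj D) (Sub v vS)).
  by rewrite inE roots_root.
by rewrite /= -(f_conn _ _ (connect_root _ _)).
Qed.

Lemma tough_separation (R : realFieldType) (t : R) (S : {set G}) (fT : finType) (f : G -> fT) :
  (0 <= t)%R -> tough t G ->
  (forall u v, u \notin S -> v \notin S -> adj u v -> f u = f v) ->
  1 < #|f @: ~: S| -> (t * #|f @: ~: S|%:R <= #|S|%:R)%R.
Proof.
move=> t0 tG f_adj f1; apply: le_trans (tG S _).
  by rewrite ler_wpM2l // ler_nat card_le_omega.
move=> conn; move: f1; rewrite ltnNge => /negP; apply.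
apply: leq_trans (card_le_omega f_adj) _.
rewrite /omega /n_comp_mem; apply/card_le1P => /= r rr s; rewrite !inE !andbT.
apply/idP/eqP => [ss|->]; last by case/andP: rr.
have csym : connect_sym (@adj (del_vertices S)) by apply: sym_connect_sym; apply: adj_sym.
case/andP: rr => /eqP rr _; rewrite -rr -(eqP ss).
by apply/(fingraph.rootP csym); apply: conn.
Qed.

(** The form in which the forbidden subgraph is used: an edge and k pairwise
    nonadjacent vertices missing both of its ends would induce it. *)
Lemma free_edge_stable (k : nat) (u v : G) (J : {set G}) :
  is_free (P2kP1 k) G -> adj u v -> stable J ->
  {in J, forall y, ~~ adj u y && ~~ adj v y} -> #|J| < k.
Proof.
move=> Gfree uv stJ uvJ; rewrite ltnNge; apply/negP=> kJ.
have [K] : exists2 K : {set G}, K \subset J & #|K| = k.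
  exists [set z in take k (enum J)].
    by apply/subsetP=> y; rewrite inE => /mem_take; rewrite mem_enum.
  rewrite cardsE (card_uniqP _) ?size_takel ?take_uniq ?enum_uniq //.
  by rewrite -cardE.
move=> /subsetP KJ Kk.
have uK : u \notin K.
  by apply/negP=> /KJ /uvJ; rewrite [adj v u]adj_sym uv andbF.
have vK : v \notin K by apply/negP=> /KJ /uvJ; rewrite uv.
have vu : v != u by apply: contraTneq uv => ->; rewrite adj_irr.
pose B := u |: (v |: K).
pose f (y : induced B) : P2kP1 k :=
  if val y == u then inl true else if val y == v then inl false else
  if insub (index (val y) (enum K)) is Some i then inr i else inl true.
have idx (y : G) : y \in K -> exists2 i : 'I_k, insub (index y (enum K)) = Some i
    & i = index y (enum K) :> nat.
  move=> yK; have ik : index y (enum K) < k by rewrite -Kk cardE index_mem mem_enum.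
  by exists (Ordinal ik) => //; rewrite insubT.
pose g (p : P2kP1 k) : G :=
  match p with inl b => if b then u else v | inr i => nth u (enum K) i end.
have fcases (y : induced B) : [\/ val y = u /\ f y = inl true, val y = v /\ f y = inl false
   | val y \in K /\ exists2 i : 'I_k, f y = inr i & i = index (val y) (enum K) :> nat].
  rewrite /f; case: eqP => [->|/eqP yu]; first by constructor 1.
  case: eqP => [->|/eqP yv]; first by constructor 2.
  have yK : val y \in K by have := valP y; rewrite !inE (negPf yu) (negPf yv).
  by constructor 3; split=> //; have [i -> iE] := idx _ yK; exists i.
have gf y : g (f y) = val y.
  case: (fcases y) => [[-> ->]|[-> ->]|[yK [i -> iE]]] //=.
  by rewrite iE nth_index // mem_enum.
apply: (Gfree B); exists f.
  apply: inj_card_bij; first by move=> y z fyz; apply: val_inj; rewrite -!gf fyz.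
  (* f is injective because g recovers the vertex from its label *)
  have -> : #|P2kP1 k| = k.+2 by rewrite card_sum card_bool card_ord.
  have -> : #|induced B| = #|B| by rewrite card_sig; apply: eq_card.
  by rewrite !cardsU1 !inE vK [u == v]eq_sym (negPf vu) (negPf uK) Kk.
move=> y z; rewrite /= /induced_adj.
case: (fcases y) => [[-> ->]|[-> ->]|[yK [i -> iE]]];
  case: (fcases z) => [[-> ->]|[-> ->]|[zK [j -> jE]]] /=;
  rewrite ?adj_irr ?uv //; apply/esym.
- by have /andP[/negPf] := uvJ _ (KJ _ zK).
- by rewrite adj_sym uv.
- by have /andP[_ /negPf] := uvJ _ (KJ _ zK).
- by rewrite adj_sym; have /andP[/negPf] := uvJ _ (KJ _ yK).
- by rewrite adj_sym; have /andP[_ /negPf] := uvJ _ (KJ _ yK).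
- exact/negbTE/stJ/KJ/zK/KJ.
Qed.
End Separation.

(** * Rerouting longest cycles *)

Section LongestCycles.
Variable G : sgraph.
Implicit Types (c p s : seq G) (u v w x y : G).

(** The empty sequence and an edge traversed back and forth compete here as
    well, so that a longest one exists trivially; any of them with at least three
    vertices is a cycle in the usual sense. *)
Definition longest_cycle c :=
  [/\ cycle (@adj G) c, uniq c &
      forall c', cycle (@adj G) c' -> uniq c' -> size c' <= size c].

Lemma next_inj c : uniq c -> injective (next c).
Proof. by move=> Uc; apply: can_inj (prev_next Uc). Qed.

(** A cycle is opened just after w. The arc is traversed by [next c], which
    identifies its second vertex when the first one is to be dropped. *)
Lemma one_arc c w : cycle (@adj G) c -> uniq c -> w \in c ->
  exists s, [/\ perm_eq (next c w :: s) c, path (@adj G) (next c w) s,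
                fpath (next c) (next c w) s & last (next c w) s = w].
Proof.
move=> Cc Uc wc; have := wc; rewrite -mem_next => /rot_to[i s def_c].
exists s; have := rot_cycle i (@adj G) c; rewrite def_c Cc /= rcons_path.
move=> /andP[-> _]; have := rot_cycle i (frel (next c)) c.
rewrite def_c cycle_next //= rcons_path => /andP[-> /= /eqP/(next_inj Uc) ->].
by split=> //; rewrite -def_c perm_rot.
Qed.

(** A cycle is cut just after w1 and just after w2. The second arc is listed
    backwards, from w1 to the successor of w2, so that in each rerouting below
    the new cycle is a concatenation of paths and the adjacencies to check are
    those at the joints. *)
Lemma two_arcs c w1 w2 : cycle (@adj G) c -> uniq c -> w1 \in c -> w2 \in c -> w1 != w2 ->
  exists s1 s2, [/\ perm_eq ((next c w1 :: s1) ++ w1 :: s2) c,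
    path (@adj G) (next c w1) s1 /\ path (@adj G) w1 s2, fpath (next c) (next c w1) s1,
    last (next c w1) s1 = w2 & last w1 s2 = next c w2].
Proof.
move=> Cc Uc w1c w2c w12; have [s [ps sadj snext slast]] := one_arc Cc Uc w1c.
move: w2c; rewrite -(perm_mem ps) => w2s.
case/splitPl: w2s ps sadj snext slast => s1 p2 lasts1.
rewrite last_cat lasts1 !cat_path lasts1.
case: p2 => [|a p] /=; first by move=> _ _ _ w21; rewrite w21 eqxx in w12.
move=> ps /and3P[s1adj _ padj] /and3P[s1next /eqP aE _] lastp.
exists s1, (rev (belast a p)).
have rE : rev (a :: p) = w1 :: rev (belast a p) by rewrite lastI rev_rcons lastp.
split=> //.
- by rewrite -rE -(permPr ps) /= perm_cons perm_cat2l perm_rev.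
- by split=> //; rewrite -lastp rev_path (eq_path (e' := @adj G)) // => y z; rewrite adj_sym.
- by have := last_rcons w1 (rev p) a; rewrite -rev_cons rE aE.
Qed.

(** Otherwise the path h, p fits between w and its successor. *)
Lemma no_insertion c w h p : longest_cycle c -> w \in c ->
  uniq (h :: p) -> ~~ has (mem c) (h :: p) -> path (@adj G) h p ->
  adj w h -> ~~ adj (last h p) (next c w).
Proof.
move=> [Cc Uc maxc] wc Up cp padj wh; apply/negP=> ph.
have [s [ps sadj _ slast]] := one_arc Cc Uc wc.
have pc' : perm_eq ((next c w :: s) ++ h :: p) (c ++ h :: p) by rewrite perm_cat2r.
have /maxc : cycle (@adj G) ((next c w :: s) ++ h :: p).
  by rewrite /= rcons_cat cat_path sadj slast /= wh rcons_path padj.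
rewrite (perm_uniq pc') cat_uniq Uc Up cp.
by rewrite (perm_size pc') size_cat /= addnS ltnNge leq_addr => /(_ isT).
Qed.

(** Otherwise the arc up to w2, the path h, p, the other arc backwards from w1,
    and the edge between the two successors form a longer cycle. *)
Lemma no_crossing c w1 w2 h p : longest_cycle c -> w1 \in c -> w2 \in c -> w1 != w2 ->
  uniq (h :: p) -> ~~ has (mem c) (h :: p) -> path (@adj G) h p ->
  adj w2 h -> adj (last h p) w1 -> ~~ adj (next c w1) (next c w2).
Proof.
move=> [Cc Uc maxc] w1c w2c w12 Up cp padj w2h pw1; apply/negP=> a12.
have [s1 [s2 [ps [s1adj s2adj] _ last1 last2]]] := two_arcs Cc Uc w1c w2c w12.
pose c' := (next c w1 :: s1) ++ (h :: p) ++ w1 :: s2.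
have pc' : perm_eq c' ((h :: p) ++ c).
  by rewrite /c' perm_catCA perm_cat2l.
have /maxc : cycle (@adj G) c'.
  rewrite /= rcons_cat cat_path s1adj last1 /= w2h rcons_cat cat_path padj /=.
  by rewrite pw1 rcons_path s2adj last2 adj_sym.
rewrite (perm_uniq pc') cat_uniq Uc Up andbT has_sym cp.
by rewrite (perm_size pc') size_cat /= addSn ltnNge leq_addl => /(_ isT).
Qed.

(** As in [no_crossing], with x joining w2 to w1 and y joining the two
    successors: the new cycle gains both x and y. *)
Lemma no_double_insertion c w1 w2 x y : longest_cycle c -> w1 \in c -> w2 \in c -> w1 != w2 ->
  x \notin c -> y \notin c -> x != y -> adj x w1 -> adj x w2 ->
  adj y (next c w1) -> ~~ adj y (next c w2).
Proof.
move=> [Cc Uc maxc] w1c w2c w12 xc yc xy xw1 xw2 ya1; apply/negP=> ya2.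
have [s1 [s2 [ps [s1adj s2adj] _ last1 last2]]] := two_arcs Cc Uc w1c w2c w12.
pose c' := y :: (next c w1 :: s1) ++ x :: w1 :: s2.
have pc' : perm_eq c' (y :: x :: c).
  by rewrite /c' perm_cons (perm_catCA (_ :: s1) [:: x] (w1 :: s2)) perm_cons.
have /maxc : cycle (@adj G) c'.
  rewrite /= ya1 rcons_cat cat_path s1adj last1 /= adj_sym xw2 xw1 rcons_path s2adj last2.
  by rewrite adj_sym.
rewrite (perm_uniq pc') (perm_size pc') /= inE eq_sym (negPf xy) xc yc Uc.
by rewrite ltnNge leqnSn => /(_ isT).
Qed.

Lemma longest_same_size c c' : longest_cycle c -> cycle (@adj G) c' -> uniq c' ->
  size c' = size c -> longest_cycle c'.
Proof. by move=> [_ _ maxc] Cc' Uc' sz; split=> // d Cd Ud; rewrite sz maxc. Qed.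

Lemma longest_rev c : longest_cycle c -> longest_cycle (rev c).
Proof.
move=> lc; have [Cc Uc _] := lc; apply: longest_same_size lc _ _ _; rewrite ?rev_uniq ?size_rev //.
by rewrite rev_cycle (eq_cycle (e' := @adj G)) // => y z; rewrite adj_sym.
Qed.

(** The vertex x takes the place of the successor of w, being adjacent to both
    of its neighbours on the cycle. *)
Lemma omit_swap c x w : longest_cycle c -> x \notin c -> w \in c -> adj x w ->
  adj x (next c (next c w)) -> exists2 c', longest_cycle c' & next c w \notin c'.
Proof.
move=> lc xc wc xw xu; have [Cc Uc _] := lc.
have [s [ps sadj snext slast]] := one_arc Cc Uc wc.
have aw : adj w (next c w) by apply: next_cycle.
case: s => [|u s] in ps sadj snext slast *.
  by rewrite /= in slast; rewrite slast adj_irr in aw.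
move: sadj snext slast => /= /andP[_ sadj] /andP[/eqP uE _] slast.
rewrite uE in xu.
have pc' : perm_eq (next c w :: rcons (u :: s) x) (x :: c).
  by rewrite -rcons_cons perm_rcons perm_cons.
have: uniq (next c w :: rcons (u :: s) x) by rewrite (perm_uniq pc') /= xc Uc.
rewrite cons_uniq => /andP[ac' Uc']; exists (rcons (u :: s) x) => //.
apply: longest_same_size lc _ Uc' _; last by have := perm_size pc' => -[].
by rewrite /= rcons_path last_rcons rcons_path sadj slast adj_sym xw xu.
Qed.

(** The new cycle starts at u, follows c up to w2, goes through x to w1, and
    runs backwards to the successor of w2, which closes up with u: it gains x
    and loses only the successor of w1. Unless u is already the end of the
    first arc, it still steps from u to the successor of u on c. *)
Lemma omit_reroute c x w1 w2 : longest_cycle c -> x \notin c ->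
  w1 \in c -> w2 \in c -> w1 != w2 -> adj x w1 -> adj x w2 ->
  let u := next c (next c w1) in adj u (next c w2) ->
  exists c', [/\ longest_cycle c', next c w1 \notin c', u \in c' &
                 u != w2 -> next c' u = next c u].
Proof.
move=> lc xc w1c w2c w12 xw1 xw2 u ua2; have [Cc Uc _] := lc.
have aw2 : ~~ adj x (next c w1).
  by apply: (no_insertion (p := [::])) lc w1c _ _ _ _; rewrite /= ?orbF // adj_sym.
have [s1 [s2 [ps [s1adj s2adj] s1next last1 last2]]] := two_arcs Cc Uc w1c w2c w12.
case: s1 => [|u' s] in ps s1adj s1next last1 *.
  by rewrite /= in last1; rewrite last1 xw2 in aw2.
move: s1adj s1next last1 => /= /andP[_ sadj] /andP[/eqP uE snext] slast.
move: ps sadj snext slast; rewrite -uE -/u => ps sadj snext slast.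
pose c' := (u :: s) ++ x :: w1 :: s2.
have pc' : perm_eq (next c w1 :: c') (x :: c).
  by rewrite /c' -cat_cons (perm_catCA (_ :: u :: s) [:: x] (w1 :: s2)) perm_cons.
have: uniq (next c w1 :: c') by rewrite (perm_uniq pc') /= xc Uc.
rewrite cons_uniq => /andP[ac' Uc']; exists c'; split=> //; last 2 first.
- by rewrite /c' /= inE eqxx.
- rewrite /c'; case: (s) snext slast => [|v s'] /=; first by move=> _ ->; rewrite eqxx.
  by move=> /andP[/eqP vE _] _ _; rewrite eqxx vE.
apply: longest_same_size lc _ Uc' _; last by have := perm_size pc' => -[].
rewrite /= rcons_cat cat_path sadj slast /= adj_sym xw2 xw1 rcons_path s2adj last2.
by rewrite adj_sym.
Qed.

Lemma next_next_neq c w : uniq c -> w \in c -> 2 < size c -> next c (next c w) != w.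
Proof.
move=> Uc wc; case/rot_to: wc => i s def_c.
rewrite -(size_rot i) -!(next_rot i Uc); move: Uc; rewrite -(rot_uniq i) def_c.
case: s {def_c} => [|a [|b s]] //=; rewrite !inE !negb_or eqxx.
move=> /and3P[/and3P[wa wb _] _ _] _.
by rewrite [a == w]eq_sym (negPf wa) eqxx eq_sym.
Qed.

End LongestCycles.

(** * The counting inequality *)

(** Multiplying the toughness bound [ND] by e and inserting the edge count [De]
    gives (7k - 6) e <= 10 d, where e is at least d + 2 - k. As d is at least
    (7k - 6) / 5, this is a quadratic inequality in k that fails for k >= 4 and
    is an equality for k = 3. *)
Lemma tight_parameters k d q D N : 3 <= k -> 0 < q -> 7 * k - 6 <= 5 * d ->
  (7 * k - 6) * N <= 10 * D -> d + q <= N -> D * (d + q + 1 - k) <= (d + q) * d ->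
  [/\ k = 3, d = 3, q = 1, D = 6 & N = 4].
Proof.
move=> k3 q0 dT ND dqN De.
(* e is the least number of neighbours in the stable set of a vertex having one *)
have [e eE] : exists e, d + q + 1 = k + e by exists (d + q + 1 - k); lia.
rewrite eE addKn in De.
have ed : (7 * k - 6) * e <= 10 * d.
  rewrite -(leq_pmul2l (m := d + q)); last by lia.
  apply: leq_trans (_ : (7 * k - 6) * N * e <= _); first by rewrite mulnCA -mulnA leq_mul2l; nia.
  by apply: leq_trans (leq_mul ND (leqnn e)) _; nia.
have k_le3 : k = 3 by nia.
subst k; have d3 : d = 3 by lia.
have q1 : q = 1 by lia.
subst d q; have e2 : e = 2 by lia.
by subst e; split; lia.
Qed.

(** * Graphs meeting the hypotheses *)

Section FreeTough.
Variable G : sgraph.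
Implicit Types (c p s : seq G) (u v w x y : G) (J S : {set G}).

Definition outside c : {set G} := [set v | v \notin c].
Definition succ_nbrs c x : {set G} := next c @: nbrs x.
Definition dominated J : {set G} := [set v | [exists u in J, adj v u]].

Lemma card_succ_nbrs c x : uniq c -> #|succ_nbrs c x| = #|nbrs x|.
Proof. by move=> Uc; apply/card_imset/next_inj. Qed.

Variable k : nat.
Hypothesis k3 : 3 <= k.
Hypothesis G3 : 3 <= #|G|.
Hypothesis Gfree : is_free (P2kP1 k) G.
(* Toughness (7k - 6) / 10 in terms of natural numbers and labellings *)
Hypothesis separation_bound : forall S (fT : finType) (f : G -> fT) j,
  (forall u v, u \notin S -> v \notin S -> adj u v -> f u = f v) ->
  1 < j <= #|f @: ~: S| -> (7 * k - 6) * j <= 10 * #|S|.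

(** H is a union of components of G - S, so S separates y from z. *)
Lemma two_components S (H : {set G}) y z : y \in H :\: S -> z \notin H :|: S ->
  (forall u v, u \in H -> v \notin S -> adj u v -> v \in H) -> 7 * k - 6 <= 5 * #|S|.
Proof.
move=> yHS zHS Hclosed.
suff: (7 * k - 6) * 2 <= 10 * #|S| by lia.
apply: (separation_bound (f := fun v => v \in H)) => [u v uS vS uv|/=].
  by apply/idP/idP => [uH|vH]; [apply: Hclosed uv | apply: Hclosed vH _ _; rewrite // adj_sym].
move: yHS zHS; rewrite !inE negb_or => /andP[yS yH] /andP[zH zS].
apply/card_gt1P; exists true, false; split=> //; apply/imsetP.
  by exists y; rewrite ?inE ?yS ?yH.
by exists z; rewrite ?inE ?zS ?(negPf zH).
Qed.

(** Suppose that an edge y y' avoids c, and let H be the component of G - c that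
    contains it and W the set of vertices of c with a neighbour in H. The
    successors of W are pairwise nonadjacent and have no neighbour in H, since
    c is longest. As W is a cut, toughness makes it have at least k elements,
    so that its successors and y y' induce the forbidden graph. *)
Lemma outside_stable c : longest_cycle c -> stable (outside c).
Proof.
move=> lc y y'; rewrite !inE => yc y'c; apply/negP=> yy'.
have [Cc Uc maxc] := lc.
have [z0 z0c] : exists z, z \in c.
  have /maxc : cycle (@adj G) [:: y; y'] by rewrite /= yy' adj_sym yy'.
  rewrite /= inE; case: (y =P y') yy' => [->|_ _ /(_ isT)]; first by rewrite adj_irr.
  by case: (c) => // z s _; exists z; rewrite mem_head.
pose e := [rel u v | [&& u \notin c, v \notin c & adj u v]].
have esym : connect_sym e.
  by apply: sym_connect_sym => u v /=; rewrite adj_sym; case: (u \in c); case: (v \in c).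
pose H := [set h | connect e y h].
have epath h p : h \notin c -> path e h p -> ~~ has (mem c) (h :: p) /\ path (@adj G) h p.
  elim: p h => [|h' p IHp] h hc /=; first by rewrite (negPf hc).
  move=> /andP[/and3P[_ h'c ->] /(IHp _ h'c)[h'p ->]]; split=> //.
  by rewrite (negPf hc).
have Hc h : h \in H -> h \notin c.
  rewrite inE => /connectP[p /(epath _ _ yc)[/hasPn pc _] ->].
  exact/pc/mem_last.
have Hpath h1 h2 : h1 \in H -> h2 \in H ->
    exists p, [/\ uniq (h1 :: p), ~~ has (mem c) (h1 :: p), path (@adj G) h1 p & last h1 p = h2].
  move=> h1H h2H; have: connect e h1 h2.
    by move: h1H h2H; rewrite !inE esym => /connect_trans; apply.
  case/connectP=> p /shortenP[p' ep' Up' _] lastp; exists p'.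
  by have [] := epath _ _ (Hc _ h1H) ep'.
pose W := [set w in c | [exists h in H, adj w h]].
have WP w : w \in W -> exists2 h, w \in c /\ h \in H & adj w h.
  by rewrite inE => /andP[wc /exists_inP[h hH wh]]; exists h.
have AH w h : w \in W -> h \in H -> ~~ adj h (next c w).
  move=> /WP[h1 [wc h1H] wh1] hH; have [p [Up pc padj <-]] := Hpath _ _ h1H hH.
  exact: (no_insertion lc wc).
have Hstep u v : u \in H -> v \notin c -> adj u v -> v \in H.
  move=> uH vc uv; have uc := Hc _ uH; move: uH; rewrite !inE => /connect_trans; apply.
  by apply: connect1; rewrite /= uc vc.
have yH : y \in H by rewrite inE connect0.
have y'H : y' \in H by apply: Hstep yH _ yy'.
have : #|next c @: W| < k.
  apply: free_edge_stable Gfree yy' _ _ => [_ _ /imsetP[w1 w1W ->] /imsetP[w2 w2W ->]|].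
    case: (eqVneq w1 w2) => [->|w12]; first by rewrite adj_irr.
    have [[h1 [w1c h1H] wh1] [h2 [w2c h2H] wh2]] := (WP _ w1W, WP _ w2W).
    have [p [Up pc padj lastp]] := Hpath _ _ h2H h1H.
    by apply: (no_crossing lc w1c w2c w12 Up pc padj wh2); rewrite lastp adj_sym.
  by move=> _ /imsetP[w wW ->]; rewrite !AH.
rewrite (card_imset _ (next_inj Uc)).
suff: 7 * k - 6 <= 5 * #|W| by lia.
have [z zHW] : exists z, z \notin H :|: W.
  have [W0|[w wW]] := set_0Vmem W; last first.
    exists (next c w); have [h [wc hH] wh] := WP _ wW.
    rewrite !inE negb_or; apply/andP; split.
      by apply/negP=> a; have := Hc (next c w); rewrite inE mem_next wc => /(_ a).
    by rewrite mem_next wc; apply/exists_inP => -[h' h'H]; rewrite adj_sym (negPf (AH _ _ wW h'H)).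
  by exists z0; rewrite W0 setU0; apply: contraL z0c => /Hc.
apply: (two_components (y := y)) zHW _.
  by rewrite inE yH andbT inE (negPf yc).
move=> u v uH vW uv; apply: (Hstep _ _ uH _ uv).
apply: contra vW => vc; rewrite inE vc; apply/exists_inP; exists u => //.
by rewrite adj_sym.
Qed.

Section OneVertex.
Variables (c : seq G) (x : G).
Hypotheses (lc : longest_cycle c) (xc : x \notin c).

Lemma nbr_on_cycle w : adj x w -> w \in c.
Proof.
apply: contraLR => wc; by apply: (outside_stable lc); rewrite inE.
Qed.

Lemma succ_not_nbr w : adj x w -> ~~ adj x (next c w).
Proof.
move=> xw; apply: (no_insertion (p := [::])) lc (nbr_on_cycle xw) _ _ _ _; rewrite //= ?orbF //.
by rewrite adj_sym.
Qed.

(** The neighbourhood of x is a cut: a neighbour of x on c has a successor that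
    is not adjacent to x. *)
Lemma degree_large : 7 * k - 6 <= 5 * #|nbrs x|.
Proof.
have [z] : exists z, z \notin [set x] :|: nbrs x.
  have [N0|[w]] := set_0Vmem (nbrs x).
    rewrite N0 setU0; apply/existsP; apply: contraLR G3 => /existsPn /= xG.
    rewrite -ltnNge -cardsT (leq_ltn_trans (subset_leq_card (_ : _ \subset [set x]))) ?cards1 //.
    by apply/subsetP => z _; have := xG z; rewrite negbK.
  rewrite inE => xw; exists (next c w); rewrite !inE negb_or succ_not_nbr // andbT.
  by apply: contraNneq xc => <-; rewrite mem_next nbr_on_cycle.
move=> zxN; apply: (two_components (y := x)) zxN _; first by rewrite !inE eqxx adj_irr.
by move=> u v /set1P ->; rewrite !inE => /negPf ->.
Qed.

Lemma degree_ge_k : k <= #|nbrs x|.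
Proof. by move: degree_large k3; clear; lia. Qed.

Lemma succ_nbrs_stable : stable (succ_nbrs c x).
Proof.
move=> _ _ /imsetP[w1 xw1 ->] /imsetP[w2 xw2 ->]; rewrite !inE in xw1 xw2.
case: (eqVneq w1 w2) => [->|w12]; first by rewrite adj_irr.
apply: (no_crossing (p := [::])) lc (nbr_on_cycle xw1) (nbr_on_cycle xw2) w12 _ _ _ _ xw1;
  by rewrite //= ?orbF // adj_sym.
Qed.

(** If y outside c were adjacent to a successor a, then, by
    [no_double_insertion], y would be adjacent to no other successor, and the
    other successors together with x would be k pairwise nonadjacent vertices
    missing y and a. *)
Lemma outside_not_succ y a : y \in outside c -> a \in succ_nbrs c x -> ~~ adj y a.
Proof.
move=> yc aA; have [Cc Uc _] := lc; have [a1w1 xw1 aE] := imsetP aA.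
case: (eqVneq x y) => [<-|xy]; first by rewrite aE succ_not_nbr // -in_set.
apply/negP=> ya.
pose J := x |: (succ_nbrs c x :\ a).
have Ja b : b \in J -> ~~ adj y b && ~~ adj a b.
  rewrite !inE => /predU1P[->|/andP[ba bA]].
    rewrite (outside_stable lc) ?inE //= ?[adj a x]adj_sym ?aE ?succ_not_nbr //.
      by rewrite inE in xw1.
    by rewrite inE in yc.
  apply/andP; split; last exact: succ_nbrs_stable.
  have [w2 xw2 bE] := imsetP bA; rewrite !inE in xw1 xw2 yc; rewrite bE.
  apply: (no_double_insertion lc (nbr_on_cycle xw1) (nbr_on_cycle xw2)) xw1 xw2 _ => //.
    by apply: contraNneq ba => w12; rewrite bE aE w12.
  by rewrite -aE.
have xA : x \notin succ_nbrs c x.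
  by apply: contra xc => /imsetP[w]; rewrite inE => /nbr_on_cycle wc ->; rewrite mem_next.
have : #|J| < k.
  apply: free_edge_stable Gfree ya _ Ja => b b'; rewrite !inE.
  case/predU1P=> [->|/andP[_ bA]]; case/predU1P=> [->|/andP[_ b'A]].
  - by rewrite adj_irr.
  - by have [w xw ->] := imsetP b'A; rewrite succ_not_nbr // -in_set.
  - by have [w xw ->] := imsetP bA; rewrite adj_sym succ_not_nbr // -in_set.
  - exact: succ_nbrs_stable.
rewrite cardsU1 !inE (negPf xA) andbF /=.
have := cardsD1 a (succ_nbrs c x); rewrite aA card_succ_nbrs //.
by move: degree_ge_k; clear; lia.
Qed.

(** The stable set on which the whole counting argument runs *)
Definition core := succ_nbrs c x :|: outside c.

Lemma core_stable : stable core.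
Proof.
move=> u v /setUP[uA|uQ] /setUP[vA|vQ].
- exact: succ_nbrs_stable.
- by rewrite adj_sym outside_not_succ.
- exact: outside_not_succ.
- exact: outside_stable lc _ _ _ _.
Qed.

Lemma card_core : #|core| = #|nbrs x| + #|outside c|.
Proof.
have [_ Uc _] := lc.
rewrite cardsU card_succ_nbrs // (_ : _ :&: _ = set0) ?cards0 ?subn0 //.
apply/setP=> v; rewrite !inE; apply/negP=> /andP[/imsetP[w xw ->]].
by rewrite mem_next nbr_on_cycle // -in_set.
Qed.

Lemma succ_in_core w : adj x w -> next c w \in core.
Proof. by move=> xw; rewrite inE; apply/orP; left; apply/imsetP; exists w; rewrite ?inE. Qed.

Lemma outside_in_core y : y \notin c -> y \in core.
Proof. by move=> yc; rewrite !inE yc orbT. Qed.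

End OneVertex.

(** A vertex v with one neighbour u in the stable set J has almost all of J as
    neighbours: those it misses are also missed by u, so there are fewer than
    k of them. *)
Lemma dominated_many J v : stable J -> v \in dominated J -> #|J| < #|nbrs v :&: J| + k.
Proof.
move=> stJ; rewrite inE => /exists_inP[u uJ vu].
rewrite -(cardsID (nbrs v) J) setIC ltn_add2l.
apply: free_edge_stable Gfree vu _ _ => [y z|y]; rewrite !inE.
  by move=> /andP[_ yJ] /andP[_ zJ]; apply: stJ.
by move=> /andP[-> yJ]; rewrite stJ.
Qed.

(** An edge both ends of which miss J would form the forbidden subgraph with J;
    hence J extends to a stable set containing every vertex that misses it. *)
Lemma undominated_stable J : stable J -> k <= #|J| -> stable (~: dominated J).
Proof.
move=> stJ kJ u v; rewrite !inE => uJ vJ; apply: contraL kJ => uv.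
rewrite -ltnNge; apply: free_edge_stable Gfree uv stJ _ => y yJ.
move: uJ vJ => /exists_inPn /(_ _ yJ) -> /exists_inPn /(_ _ yJ) -> //.
Qed.

Lemma stable_tough J : stable J -> 1 < #|J| -> (7 * k - 6) * #|J| <= 10 * #|~: J|.
Proof.
move=> stJ J1; apply: (separation_bound (f := id)) => [u v uJ vJ uv|].
  by rewrite !inE !negbK in uJ vJ; rewrite (negPf (stJ _ _ uJ vJ)) in uv.
by rewrite J1 setCK imset_id leqnn.
Qed.

Lemma sub_undominated J : stable J -> J \subset ~: dominated J.
Proof.
by move=> stJ; apply/subsetP=> u uJ; rewrite !inE; apply/exists_inPn => v vJ; apply: stJ.
Qed.

Lemma double_count J : \sum_(v in dominated J) #|nbrs v :&: J| = \sum_(u in J) #|nbrs u|.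
Proof.
under eq_bigr do rewrite -sum1_card.
under [RHS]eq_bigr do rewrite -sum1_card.
rewrite (exchange_big_dep (mem J)) /= => [|v u vD]; last by rewrite !inE => /andP[].
apply: eq_bigr => u uJ; apply: eq_bigl => v.
rewrite !inE uJ andbT adj_sym andb_idl // => uv; apply/exists_inP; exists u => //.
by rewrite adj_sym.
Qed.

(** The maximality of the degree of x bounds the degree of every vertex that
    some longest cycle omits. *)
Definition extremal c x := [/\ longest_cycle c, x \notin c &
  forall c' y, longest_cycle c' -> y \notin c' -> #|nbrs y| <= #|nbrs x|].

Section Extremal.
Variables (c : seq G) (x : G).
Hypothesis cx : extremal c x.

Lemma extremal_rev : extremal (rev c) x.
Proof.
have [lc xc maxx] := cx; split=> //; last by rewrite mem_rev.
exact: longest_rev.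
Qed.

(** Let u be the vertex after a = [next c w]. As u has a neighbour in the
    core, namely a, it has so many that one of them is x or a second successor
    of a neighbour of x: the vertices outside c other than x, together with a,
    are too few. Then a can be replaced by x directly ([omit_swap]) or after
    rerouting ([omit_reroute]). The last clause keeps track of the vertex after
    u, so that the argument can be repeated on the new cycle. *)
Lemma omit_succ w : adj x w -> exists c',
  [/\ longest_cycle c', next c w \notin c' &
      ~~ adj x (next c (next c w)) ->
      next c (next c w) \in c' /\ next c' (next c (next c w)) = next c (next c (next c w))].
Proof.
move=> xw; have [lc xc _] := cx; have [Cc Uc _] := lc.
have wc := nbr_on_cycle lc xc xw.
set u := next c (next c w).
case: (boolP (adj x u)) => [xu|xu].
  by have [c' lc' ac'] := omit_swap lc xc wc xw xu; exists c'.
have ua : adj (next c w) u by apply: next_cycle; rewrite ?mem_next.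
have uD : u \in dominated (core c x).
  by rewrite inE; apply/exists_inP; exists (next c w); rewrite ?succ_in_core // adj_sym.
have := dominated_many (core_stable lc xc) uD; rewrite card_core // => many.
suff /exists_inP[w2] : [exists w2 in nbrs x, (w2 != w) && adj u (next c w2)].
  rewrite inE => xw2 /andP[w2w ua2]; rewrite eq_sym in w2w.
  have := omit_reroute lc xc wc (nbr_on_cycle lc xc xw2) w2w xw xw2 ua2.
  move=> [c' [lc' ac' uc' nextu]]; exists c'; split=> // _; split=> //.
  by apply: nextu; apply: contraNneq xu => uw2; rewrite /u uw2.
apply: contraLR many => /exists_inPn none; rewrite -leqNgt.
have sub : nbrs u :&: core c x \subset next c w |: (outside c :\ x).
  apply/subsetP=> v; rewrite !inE => /andP[uv /orP[/imsetP[w2 xw2 vE]|vc]].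
    have := none _ xw2; rewrite negb_and negbK -vE uv orbF => /eqP w2w.
    by rewrite vE w2w eqxx.
  by rewrite vc andbT; apply/orP; right; apply: contraNneq xu => <-; rewrite adj_sym.
have := subset_leq_card sub; rewrite cardsU1.
have := cardsD1 x (outside c); rewrite inE xc.
have := degree_ge_k lc xc.
by move: k3; clear; case: (_ \notin _) => /=; lia.
Qed.

Lemma core_degree v : v \in core c x -> #|nbrs v| <= #|nbrs x|.
Proof.
have [lc xc maxx] := cx.
case/setUP=> [/imsetP[w]|]; rewrite inE; last exact: maxx.
by move=> /omit_succ[c' [lc' ac' _]] ->; apply: maxx ac'.
Qed.


(** The vertices with a neighbour in the core J each have at least
    |J| + 1 - k of them, and by [core_degree] the degrees in J sum up to at most
    |J| deg x. Those without one form a stable set containing J, to which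
    toughness applies. *)
Lemma extremal_parameters : [/\ k = 3, #|nbrs x| = 3, #|outside c| = 1,
  #|dominated (core c x)| = 6 & #|~: dominated (core c x)| = 4].
Proof.
have [lc xc maxx] := cx; set J := core c x; set D := dominated J.
have stJ : stable J by apply: core_stable.
have JE : #|J| = #|nbrs x| + #|outside c| by apply: card_core.
have q0 : 0 < #|outside c| by apply/card_gt0P; exists x; rewrite inE.
have dk := degree_ge_k lc xc; have dT := degree_large lc xc.
have JD : #|J| <= #|~: D| by apply/subset_leq_card/sub_undominated.
apply: (tight_parameters k3 q0 dT); rewrite -?JE //.
  have := @stable_tough (~: D); rewrite setCK; apply; last by move: JE JD q0 dk k3; clear; lia.
  by apply: undominated_stable; rewrite // JE (leq_trans dk) ?leq_addr.
rewrite -sum_nat_const.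
apply: leq_trans (_ : \sum_(v in D) #|nbrs v :&: J| <= _).
  apply: leq_sum => v vD; have := dominated_many stJ vD; clear; lia.
rewrite double_count -sum_nat_const; apply: leq_sum => u uJ; exact: core_degree.
Qed.

End Extremal.

(** * The extremal case *)

Section Tight.
Variables (c : seq G) (x : G).
Hypothesis cx : extremal c x.
Let J := core c x.
Let D := dominated J.
Let params : [/\ k = 3, #|nbrs x| = 3, #|outside c| = 1, #|D| = 6 & #|~: D| = 4]
  := extremal_parameters cx.
Let lc : longest_cycle c. Proof. by case: cx. Qed.
Let xc : x \notin c. Proof. by case: cx. Qed.
Let stJ : stable J. Proof. exact: core_stable. Qed.

Lemma card_G : #|G| = 10.
Proof. by case: params => _ _ _ D6 N4; rewrite -(cardsC D) D6 N4. Qed.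

Lemma card_core4 : #|J| = 4.
Proof. by case: params => _ d3 q1 _ _; rewrite card_core // d3 q1. Qed.

Lemma undominated_core : ~: D = J.
Proof.
apply/esym/eqP; rewrite eqEcard sub_undominated // card_core4.
by case: params => _ _ _ _ ->.
Qed.

Lemma size_cycle : size c = 9.
Proof.
case: params => _ _ q1 _ _; have [_ Uc _] := lc.
have := cardsC (outside c); rewrite q1 card_G => -[<-].
by rewrite -(card_uniqP Uc); apply: eq_card => v; rewrite !inE negbK.
Qed.

(** Equality holds throughout the double count over D and J. *)
Lemma two_core_nbrs v : v \in D -> #|nbrs v :&: J| = 2.
Proof.
case: params => k_3 d3 q1 D6 _ vD.
have ge2 u : u \in D -> 2 <= #|nbrs u :&: J|.
  by move=> /(dominated_many stJ); rewrite card_core4 k_3; clear; lia.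
have : \sum_(u in D) #|nbrs u :&: J| <= 12.
  rewrite double_count; apply: leq_trans (_ : \sum_(u in J) 3 <= _).
    by apply: leq_sum => u uJ; rewrite -d3; apply: (core_degree cx).
  by rewrite sum_nat_const card_core4.
rewrite (bigD1 v) //=.
have : \sum_(u in D | u != v) 2 <= \sum_(u in D | u != v) #|nbrs u :&: J|.
  by apply: leq_sum => u /andP[uD _]; apply: ge2.
rewrite (eq_bigl (mem (D :\ v))) => [|u]; last by rewrite !inE andbC.
rewrite sum_nat_const; have := cardsD1 v D; rewrite vD D6.
by move: (ge2 _ vD); clear; lia.
Qed.

(** Otherwise the nonadjacent vertices x and a, of degree at most 3, share two
    neighbours, and their at most four neighbours separate x, a and the rest
    of the graph, whereas 3/2-toughness needs five vertices for that. *)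
Lemma succ2_not_nbr w : adj x w -> ~~ adj x (next c (next c w)).
Proof.
move=> xw; set a := next c w; set b := next c a; apply/negP => xb.
have [Cc Uc _] := lc; have [k_3 d3 _ _ _] := params.
have wc := nbr_on_cycle lc xc xw.
have bw : b != w by rewrite next_next_neq // size_cycle.
have ab : adj a b by apply: next_cycle; rewrite ?mem_next.
have aw : adj a w by rewrite adj_sym; apply: next_cycle.
have xa : ~~ adj x a by apply: succ_not_nbr.
have aJ : a \in J by apply: succ_in_core.
pose S := nbrs x :|: nbrs a.
have S4 : #|S| <= 4.
  have := cardsUI (nbrs x) (nbrs a); rewrite -/S d3.
  have : #|[set b; w]| <= #|nbrs x :&: nbrs a|.
    apply/subset_leq_card/subsetP=> v; rewrite !inE => /orP[]/eqP ->; exact/andP.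
  rewrite cards2 bw; have := core_degree cx aJ; rewrite d3.
  by clear; lia.
(* The labels of the parts {x}, {a} and the rest *)
pose f v := if v == x then None else Some (v == a).
have ax : a != x by apply: contraNneq xc => <-; rewrite mem_next.
suff : (7 * k - 6) * 3 <= 10 * #|S| by move: k_3 S4; clear; lia.
apply: (separation_bound (f := f)) => [u v|].
  rewrite !inE !negb_or /f => /andP[ux ua] /andP[vx va] uv.
  rewrite (negPf (_ : u != x)); last by apply: contraNneq vx => <-.
  rewrite (negPf (_ : v != x)); last by apply: contraNneq ux => <-; rewrite adj_sym.
  rewrite (negPf (_ : u != a)); last by apply: contraNneq va => <-.
  by rewrite (negPf (_ : v != a)) //; apply: contraNneq ua => <-; rewrite adj_sym.
have [z] : exists z, z \notin x |: (a |: S).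
  apply/existsP; apply: contraTT isT => /existsPn /= zS.
  have : #|[set: G]| <= #|x |: (a |: S)|.
    by apply/subset_leq_card/subsetP=> z _; have := zS z; rewrite negbK.
  by rewrite cardsT card_G !cardsU1; move: S4; clear; do 2 case: (_ \notin _); lia.
rewrite 2!inE negb_or => /andP[zx]; rewrite 2!inE negb_or => /andP[za zS].
apply/andP; split=> //.
have <- : #|[set: option bool]| = 3 by rewrite cardsT card_option card_bool.
apply/subset_leq_card/subsetP=> -[[]|] _; apply/imsetP.
- by exists a; rewrite /f ?(negPf ax) ?eqxx // !inE negb_or adj_irr xa.
- by exists z; rewrite /f ?(negPf zx) ?(negPf za) // inE.
- by exists x; rewrite /f ?eqxx // !inE negb_or adj_irr adj_sym.
Qed.

(** The cycle consists of three consecutive triples: a successor a of a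
    neighbour of x, then a vertex of D missing x, then a neighbour of x. *)
Lemma dominated_split : next c @: succ_nbrs c x = D :\: nbrs x.
Proof.
have [Cc Uc _] := lc; have [_ d3 _ D6 _] := params.
have WD : nbrs x \subset D.
  apply/subsetP=> w; rewrite !inE => xw; apply/exists_inP; exists x.
    exact: outside_in_core.
  by rewrite adj_sym.
apply/eqP; rewrite eqEcard (card_imset _ (next_inj Uc)) card_succ_nbrs // cardsD.
rewrite (setIidPr WD) d3 D6 andbT; apply/subsetP=> _ /imsetP[_ /imsetP[w xw ->] ->].
rewrite inE in xw; rewrite !inE succ2_not_nbr //=; apply/exists_inP.
exists (next c w); first exact: succ_in_core.
by rewrite adj_sym; apply: next_cycle; rewrite // mem_next (nbr_on_cycle lc xc).
Qed.

Lemma core_on_cycle v : v \in c -> (v \in J) = (v \in succ_nbrs c x).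
Proof. by move=> vc; rewrite [in LHS]inE [v \in outside c]inE vc orbF. Qed.

Lemma notin_core v : (v \notin J) = (v \in D).
Proof. by rewrite -undominated_core inE negbK. Qed.

(** Each vertex v is omitted by some longest cycle. For a vertex of the core,
    this is known. For a vertex v whose predecessor on c is in the core, reverse
    c: v then comes just after a neighbour of x. For a neighbour v of x, let u be its
    predecessor and a the predecessor of u: some longest cycle omits a but
    still steps from its neighbour u to v, so the argument applied to a and
    that cycle omits v. *)
Lemma cubic v : #|nbrs v| <= 3.
Proof.
have [Cc Uc _] := lc; have [k_3 d3 q1 D6 _] := params.
have [vJ|] := boolP (v \in J); first by rewrite -d3; apply: (core_degree cx).
move=> vJ; have vD : v \in D by rewrite -notin_core.
have vc : v \in c by apply: contraR vJ => /outside_in_core; apply.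
have [xv|xv] := boolP (adj x v); last first.
  have vW : v \in D :\: nbrs x by rewrite in_setD inE xv.
  have xv' : adj x (next c v).
    have nc : next c v \in c by rewrite mem_next.
    have nD : next c v \in D.
      rewrite -notin_core core_on_cycle //; apply/imsetP=> -[w xw /(next_inj Uc) vw].
      by rewrite vw in xv; rewrite inE (negPf xv) in xw.
    apply: contraNT vJ => nx; have : next c v \in D :\: nbrs x by rewrite in_setD inE nx.
    rewrite -dominated_split => /imsetP[a aA /(next_inj Uc) ->].
    by rewrite inE aA.
  rewrite -d3 -(prev_next Uc v) -next_rev //.
  by apply: (core_degree (extremal_rev cx)); apply: succ_in_core.
have uc : prev c v \in c by rewrite mem_prev.
have vE : next c (prev c v) = v by apply: next_prev.
have uJ : prev c v \notin J.
  rewrite core_on_cycle //; apply/negP=> uA.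
  have : v \in D :\: nbrs x by rewrite -dominated_split -vE imset_f.
  by rewrite in_setD inE xv.
have xu : ~~ adj x (prev c v).
  apply: contra vJ => xu; rewrite -vE; exact: succ_in_core.
have : prev c v \in D :\: nbrs x by rewrite in_setD inE xu -notin_core.
rewrite -dominated_split => /imsetP[a /imsetP[w xw aE] uE]; rewrite inE in xw.
have [c' [lc' ac' nextc']] := omit_succ cx xw.
rewrite -aE -uE vE in ac' nextc'; have [_ nextu] := nextc' xu.
(* 3 is the least degree allowed by toughness outside a longest cycle *)
have c'a : extremal c' a.
  split=> // c'' y lc'' yc''; have [_ _ maxx] := cx.
  apply: leq_trans (maxx _ _ lc'' yc'') _; rewrite d3.
  by have := degree_large lc' ac'; rewrite k_3; clear; lia.
have au : adj a (prev c v).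
  by rewrite uE; apply: next_cycle; rewrite // aE mem_next (nbr_on_cycle lc xc).
have [c'' [lc'' vc'' _]] := omit_succ c'a au.
by rewrite nextu in vc''; rewrite -d3; have [_ _] := cx; apply; eassumption.
Qed.

(** Each of the six vertices of D has two neighbours among the four vertices of
    J, hence at most one in D: removing J leaves at least three components. *)
Lemma no_extremal : False.
Proof.
have [k_3 d3 q1 D6 _] := params.
(* On D, f v is the vertex set of the component of v in G - J *)
pose f v := v |: (nbrs v :&: D).
have nbrsD v : v \in D -> #|nbrs v :&: D| <= 1.
  move=> vD; have := cardsID J (nbrs v); rewrite two_core_nbrs //.
  rewrite setDE -undominated_core setCK.
  by move: (cubic v); clear; lia.
have nbrs1 u v : u \in D -> v \in D -> adj u v -> nbrs u :&: D = [set v].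
  by move=> uD vD uv; apply/esym/eqP; rewrite eqEcard sub1set in_setI inE uv vD cards1 nbrsD.
suff : (7 * k - 6) * 3 <= 10 * #|J| by rewrite card_core4 k_3; clear; lia.
apply: (separation_bound (f := f)) => [u v|].
  rewrite !notin_core => uD vD uv; rewrite /f (nbrs1 u v) // (nbrs1 v u) 1?adj_sym //.
  by rewrite setUC.
rewrite -undominated_core setCK andTb.
have : #|D| <= \sum_(B in f @: D) #|B|.
  apply: leq_trans (leq_card_cover _); apply/subset_leq_card/subsetP=> v vD.
  by apply/bigcupP; exists (f v); rewrite ?imset_f // !inE eqxx.
rewrite D6; have : \sum_(B in f @: D) #|B| <= \sum_(B in f @: D) 2.
  apply: leq_sum => _ /imsetP[v vD ->]; rewrite /f cardsU1.
  by move: (nbrsD _ vD); clear; case: (_ \notin _); lia.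
by rewrite sum_nat_const; clear; lia.
Qed.

End Tight.

End FreeTough.

(** * Conclusion *)

Lemma exists_longest_cycle (G : sgraph) : exists c : seq G, longest_cycle c.
Proof.
pose P m := [exists t : m.-tuple G, cycle (@adj G) t && uniq t].
have P0 : exists m, P m by exists 0; apply/existsP; exists [tuple].
have bound m : P m -> m <= #|G|.
  case/existsP=> t /andP[_ /card_uniqP tE].
  by rewrite -(size_tuple t) -tE max_card.
have [m /existsP[t /andP[Ct Ut]] maxm] := ex_maxnP P0 bound.
exists t; split=> // c Cc Uc; rewrite size_tuple; apply: maxm.
by apply/existsP; exists (in_tuple c); rewrite Cc.
Qed.

Lemma exists_extremal (G : sgraph) (c : seq G) (x : G) :
  longest_cycle c -> x \notin c -> exists c' x', @extremal G c' x'.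
Proof.
move=> lc xc; have [Cc Uc maxc] := lc.
pose P d := [exists t : (size c).-tuple G, [exists y : G,
  [&& cycle (@adj G) t, uniq t, y \notin t & #|nbrs y| == d]]].
have Pdeg (c' : seq G) (y : G) : longest_cycle c' -> y \notin c' -> P #|nbrs y|.
  move=> [Cc' Uc' maxc'] yc'.
  have sz : size c' == size c by rewrite eqn_leq (maxc _ Cc' Uc') (maxc' _ Cc Uc).
  by apply/existsP; exists (Tuple sz); apply/existsP; exists y; rewrite Cc' Uc' yc' eqxx.
have P0 : exists d, P d by exists #|nbrs x|; apply: (Pdeg c).
have bound d : P d -> d <= #|G|.
  by case/existsP=> t /existsP[y /and4P[_ _ _ /eqP <-]]; apply: max_card.
have [d /existsP[t /existsP[y /and4P[Ct Ut yt /eqP yd]]] maxd] := ex_maxnP P0 bound.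
exists t, y; split=> // [|c' z lc' zc'].
  exact: longest_same_size lc Ct Ut (size_tuple t).
by rewrite yd; apply: maxd; apply: (Pdeg c').
Qed.

Local Open Scope ring_scope.
Unset Implicit Arguments.

Theorem corollary1p1 (R : realFieldType) (k : nat) (hk : (3 <= k)%N)
  (G : sgraph) (hG : (3 <= #|G|)%N)
  (htough : tough ((7 * k%:R - 6) / 10 : R) G)
  (hfree : is_free (P2kP1 k) G) :
  hamiltonian G \/ isomorphic G petersen.
Proof.
left; have [c lc] := exists_longest_cycle G; have [Cc Uc _] := lc.
have [/forallP Vc|] := boolP [forall x : G, x \in c].
  exists c => //; split=> //; apply: leq_trans hG _.
  by rewrite -(card_uniqP Uc); apply/subset_leq_card/subsetP=> x _; apply: Vc.
rewrite negb_forall => /existsP[x xc].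
have [c' [x' c'x']] := exists_extremal lc xc.
have k3 : 3 <= k%:R :> R by rewrite ler_nat.
exfalso; apply: (no_extremal hk hG hfree) c'x' => S fT f j f_adj /andP[j1 jf].
have t0 : 0 <= (7 * k%:R - 6) / 10 :> R by lra.
have := tough_separation t0 htough f_adj (leq_trans j1 jf).
have : (7 * k%:R - 6) / 10 * j%:R <= (7 * k%:R - 6) / 10 * #|f @: ~: S|%:R :> R.
  by rewrite ler_wpM2l // ler_nat.
move=> /le_trans/[apply] jS; rewrite -(ler_nat R) !natrM natrB ?natrM; last by lia.
by lra.
Qed.
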